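(* Let $P\ge 1$, $f:[0,1]^P\to\mathbb{R}$, and let data $(\mathbf{x}_n,y_n)$, $n=1,\dots,N$, be generated by $y_n=f(\mathbf{x}_n)+\epsilon_n$. For each $N$ let a regression tree of depth $S(N)$ be built from the data by cyclic median splitting, and suppose Assumptions 0, 1 and 2 (all written out in the context) hold. For $\mathbf{x}\in[0,1]^P$ and $p\in\{1,\dots,P\}$ let $\frac{\tilde\partial^N f(\mathbf{x})}{\tilde\partial x_p}$ denote the $p$-th component of the tree-based gradient estimate (TBGE) at $\mathbf{x}$ with sample size $N$. Then for every $\mathbf{x}\in[0,1]^P$ and every $p\in\{1,\dots,P\}$, as $N\to\infty$, $$\frac{\tilde\partial^N f(\mathbf{x})}{\tilde\partial x_p}=\frac{\partial f(\mathbf{x})}{\partial x_p}+O_P\left(\frac{2^{\frac{P+2}{2P}S(N)}}{\sqrt N}+P\,2^{-\frac{S(N)}{P}}\right),$$ where $O_P$ denotes boundedness in probability (the $P$ elsewhere is the dimension).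
   Context: Data. $\mathbf{x}_n\in[0,1]^P$ are random input points, $y_n=f(\mathbf{x}_n)+\epsilon_n\in\mathbb{R}$, and the errors $\epsilon_n$ have mean zero and finite variance. Tree. For each $N$ the tree is a full binary tree whose leaves are all at depth $S(N)\in\mathbb{N}$ (the root, at depth $0$, has index $0$). Each node $i$ has an extent $[\mathbf{l}^i,\mathbf{u}^i]=\prod_{p=1}^P[l^i_p,u^i_p]$; the root has extent $[0,1]^P$. A non-leaf node $i$ splits along a variable $\sigma_i\in\{1,\dots,P\}$ at a threshold $\tau^i$: points of node $i$ with $x_{\sigma_i}\le\tau^i$ go to the left child $c^i_l$, and those with $x_{\sigma_i}>\tau^i$ go to the right child $c^i_r$. The extents of the children are obtained by cutting the extent of $i$ at $\tau^i$ along coordinate $\sigma_i$. Cyclic median splitting: all nodes at the same depth split along the same variable, the variables being cycled through in the order $1,2,\dots,P,1,2,\dots$ as the depth increases (the root splits along variable $1$), and $\tau^i$ is the median of the $\sigma_i$-coordinates of the input points lying in node $i$, so that each child receives about half of the data of node $i$. $B^k(\mathbf{x})$ is the node at depth $k$ containing $\mathbf{x}$, and $D_i$ is the depth of node $i$. Gradient estimate. For a non-leaf node $i$, let $\hat\mu^i_l$ and $\hat\mu^i_r$ be the averages of the $y_n$ over those $n$ for which $\mathbf{x}_n$ lies in the left, respectively right, child of $i$, and put $$\gamma_i=\frac{2(\hat\mu^i_r-\hat\mu^i_l)}{u^i_{\sigma_i}-l^i_{\sigma_i}}.$$ The $p$-th component of the TBGE at $\mathbf{x}$ is $\gamma_i$,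 where $i$ is the deepest non-leaf node containing $\mathbf{x}$ with $\sigma_i=p$ (and it is $0$ if there is no such node). Assumption 0. $\lim_{N\to\infty}S(N)=\infty$ and $\lim_{N\to\infty}S(N)/\log N=0$. Assumption 1. The input points are sampled from a distribution such that for every $\epsilon>0$ there are constants $C_-,C_+>0$ such that, for every node $i$ (this includes nodes of the form $B^k(\mathbf{x})$ for a fixed point $\mathbf{x}$), $$\Pr\left(C_-2^{-D_i/P}\le|u^i_p-l^i_p|\le C_+2^{-D_i/P}\right)>1-\epsilon\quad\text{for all }p\in\{1,\dots,P\}.$$ Assumption 2. (1) Sample means over nodes converge at the usual square-root rate to the mean of $f$ over the node: for every $\mathbf{x}\in[0,1]^P$ and depths $0\le k_N\le S(N)-1$, with $i=B^{k_N}(\mathbf{x})$ and $c\in\{l,r\}$, $$\hat\mu^i_c=\mathbb{E}_{\mathbf{z}\sim U([\mathbf{l}^{c^i_c},\mathbf{u}^{c^i_c}])}[f(\mathbf{z})]+O_P\left(\sqrt{2^{S(N)}/N}\right),$$ where $U$ denotes the uniform distribution and the expectation is over $\mathbf{z}$ only (the node being held fixed). (2) $f$ is twice differentiable and there is $H<\infty$ with $\|\nabla^2 f(\mathbf{x})\|\le H$ (operator norm) for all $\mathbf{x}\in[0,1]^P$. *)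

(* Defs.v *)
From HB Require Import structures.
From mathcomp Require Import all_boot all_order all_algebra.
From mathcomp Require Import all_classical all_reals all_analysis.

Set Implicit Arguments.
Unset Strict Implicit.
Unset Printing Implicit Defensive.

Import Order.TTheory GRing.Theory Num.Theory.
Import numFieldNormedType.Exports.

Local Open Scope classical_set_scope.
Local Open Scope ring_scope.

Section calculus_on_the_cube.
Context {R : realType} {P : nat}.
Implicit Types (f : 'rV[R]_P -> R) (x v : 'rV[R]_P) (p : 'I_P).

Definition cube : set 'rV[R]_P := [set x | forall p, 0 <= x 0 p <= 1].

(* Functions on the cube are represented by total functions on R^P; all the
   notions below only look at their values on the cube, so that derivatives
   are one-sided in the relevant directions at boundary points. *)

Definition differentiable_on_cube f x : Prop :=
  exists g : 'rV[R]_P, forall e : R, 0 < e ->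
    \forall z \near within cube (nbhs x),
      `|f z - f x - \sum_p g 0 p * (z 0 p - x 0 p)| <= e * `|z - x|.

Definition partial f p x : R :=
  lim (h^-1 * (f (x + h *: delta_mx 0 p) - f x)
    @[h --> within [set h | cube (x + h *: delta_mx 0 p)] 0^']).

Definition twice_differentiable_on_cube f : Prop :=
  forall x, cube x -> differentiable_on_cube f x /\
    forall p, differentiable_on_cube (partial f p) x.

Definition hessian f x : 'M[R]_P :=
  \matrix_(p, q) partial (partial f p) q x.

(* The norm `|v| of the library is the sup norm. *)
Definition euclid_norm v : R := Num.sqrt (\sum_p v 0 p ^+ 2).

Definition operator_norm (A : 'M[R]_P) : R :=
  sup [set euclid_norm (v *m A) | v in [set v | euclid_norm v <= 1]].

Definition set_coord x p (t : R) : 'rV[R]_P :=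
  \row_q (if q == p then t else x 0 q).

(* E[f(z)] for z uniform on the box [l, u]: the coordinates of z are
   independent and z_p is distributed as l_p + t (u_p - l_p) with t uniform on
   [0, 1], so the expectation is an iterated integral, one coordinate at a
   time.  If l_p = u_p then z_p is the constant l_p. *)
Definition uniform_mean (l u : 'rV[R]_P) f : R :=
  foldr (fun p (g : 'rV[R]_P -> R) z =>
           \int[lebesgue_measure]_(t in `[0, 1])
             g (set_coord z p (l 0 p + t * (u 0 p - l 0 p))))
        f (enum 'I_P) l.

End calculus_on_the_cube.

(* Usual convention: the middle order statistic for a sample of odd size, the
   average of the two middle ones for a sample of even size. *)
Definition median {R : realType} (s : seq R) : R :=
  let s' := sort <=%O s in
  (nth 0 s' (size s).-1./2 + nth 0 s' (size s)./2) / 2.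

Section tree.
Context {R : realType} {P : nat} (P_gt0 : (0 < P)%N).

(* The sample is (X n, y n) for n < N. *)
Variables (N : nat) (X : nat -> 'rV[R]_P) (y : nat -> R).

(* 0-based: depth k splits along variable k mod P. *)
Definition split_var (k : nat) : 'I_P := Ordinal (ltn_pmod k P_gt0).

(* A node is addressed by the list of turns leading to it from the root, last
   turn first, with true for right and false for left: the root is [::], the
   depth of i is [size i] and its children are [false :: i] and [true :: i]. *)
Definition node := seq bool.

Record cell := Cell { lo : 'rV[R]_P; hi : 'rV[R]_P; obs : seq nat }.

(* A node without data has no median; it is cut at the middle. *)
Definition cell_threshold (p : 'I_P) (c : cell) : R :=
  if obs c is [::] then (lo c 0 p + hi c 0 p) / 2
  else median [seq X n 0 p | n <- obs c].

Definition cell_child (p : 'I_P) (right : bool) (c : cell) : cell :=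
  let t := cell_threshold p c in
  if right
  then Cell (set_coord (lo c) p t) (hi c) [seq n <- obs c | t < X n 0 p]
  else Cell (lo c) (set_coord (hi c) p t) [seq n <- obs c | X n 0 p <= t].

Fixpoint cell_of (i : node) : cell :=
  if i is b :: j then cell_child (split_var (size j)) b (cell_of j)
  else Cell (const_mx 0) (const_mx 1) (iota 0 N).

Definition threshold (i : node) : R :=
  cell_threshold (split_var (size i)) (cell_of i).

Definition lower (i : node) : 'rV[R]_P := lo (cell_of i).
Definition upper (i : node) : 'rV[R]_P := hi (cell_of i).

Definition width (i : node) (p : 'I_P) : R := upper i 0 p - lower i 0 p.

(* B^k(x) *)
Fixpoint node_at (x : 'rV[R]_P) (k : nat) : node :=
  if k is k'.+1 then
    let i := node_at x k' in (threshold i < x 0 (split_var k')) :: i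
  else [::].

Definition node_mean (i : node) : R :=
  (\sum_(n <- obs (cell_of i)) y n) / (size (obs (cell_of i)))%:R.

Definition node_slope (i : node) : R :=
  2 * (node_mean (true :: i) - node_mean (false :: i))
  / width i (split_var (size i)).

(* The non-leaf nodes are those of depth < S.  [last 0] picks the deepest one
   splitting along p, and returns 0 if there is none. *)
Definition tbge (S : nat) (x : 'rV[R]_P) (p : 'I_P) : R :=
  last 0 [seq node_slope (node_at x k) | k <- iota 0 S & split_var k == p].

End tree.

Section probability.
Context {R : realType} {d : measure_display} {T : measurableType d}.

(* Z_N = O_Pr(r_N).  Probabilities of events are written with the outer
   measure Pr^*, which equals Pr on measurable sets
   (measurable_mu_extE), so that measurability of the events need not be
   established beforehand. *)
Definition bounded_in_probability (Pr : probability T R)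
    (Z : nat -> T -> R) (r : nat -> R) : Prop :=
  forall e : R, 0 < e -> exists2 M : R, 0 < M &
    \forall N \near \oo,
      ((Pr^*)%mu [set w | (M * r N < `|Z N w|)%R] < e%:E)%E.

(* Pr(A) > q, expressed as Pr(complement of A) < 1 - q. *)
Definition probability_gt (Pr : probability T R) (A : set T) (q : R) : Prop :=
  ((Pr^*)%mu (~` A) < (1 - q)%:E)%E.

End probability.

(* Main.v *)
(* The two children of a node differ only in their extent along the split
   variable, and the midpoints of these two extents are half the width [w] of
   the node apart.  For an affine function, twice the difference of the means
   over the children, divided by [w], is therefore exactly the partial
   derivative.  The bound on the Hessian makes [f] affine up to [C r^2] on a
   node of diameter at most [r] containing [x], so the slope of that node is off
   by at most [4 (m + C r^2) / w], where [m] bounds the errors of the two sample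
   means.  The deepest split along [p] occurs at a depth in [[S - P, S - 1]],
   where with high probability [w] and [r] are both of order [2^(-S/P)] and [m]
   is of order [sqrt (2^S / N)].  Averages over boxes are handled one coordinate
   at a time: averaging in one coordinate preserves both the Lipschitz constant
   (hence integrability) and the distance to an affine function. *)
Require Import Defs.
From HB Require Import structures.
From mathcomp Require Import all_boot all_order all_algebra.
From mathcomp Require Import all_classical all_reals all_analysis.
From mathcomp Require Import ring lra zify.

Set Implicit Arguments.
Unset Strict Implicit.
Unset Printing Implicit Defensive.

Import Order.TTheory GRing.Theory Num.Theory.
Import numFieldNormedType.Exports.

Local Open Scope classical_set_scope.
Local Open Scope ring_scope.

(** * Coordinates and the sup norm *)

Section norms.
Context {R : realType} {P : nat}.
Implicit Types (v : 'rV[R]_P).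

Lemma normr_coord_le v p : `|v 0 p| <= `|v|.
Proof.
rewrite [leRHS]/Num.norm /= mx_normrE.
exact: (le_bigmax _ (fun ij : 'I_1 * 'I_P => `|v ij.1 ij.2|) (0, p)).
Qed.

Lemma normr_row_le v (B : R) :
  0 <= B -> (forall p, `|v 0 p| <= B) -> `|v| <= B.
Proof.
move=> B0 vB; rewrite [leLHS]/Num.norm /= mx_normrE.
by apply: bigmax_le => // -[i j] _ /=; rewrite (ord1 i).
Qed.

End norms.

(** * Differentiation on the cube and the mean value inequality *)

Section gradient.
Context {R : realType} {P : nat}.
Implicit Types (f : 'rV[R]_P -> R) (x z d g : 'rV[R]_P) (p q : 'I_P).

(** The condition of [differentiable_on_cube] with its witness exposed, so that the witness can be
    identified with the partial derivatives. *)
Definition is_gradient f x g : Prop := forall e : R, 0 < e ->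
  \forall z \near within cube (nbhs x),
    `|f z - f x - \sum_p g 0 p * (z 0 p - x 0 p)| <= e * `|z - x|.

Lemma cube_segment x z (t : R) :
  cube x -> cube z -> 0 <= t <= 1 -> cube (x + t *: (z - x)).
Proof.
by move=> cx cz t01 q; rewrite !mxE; have := cx q; have := cz q; nra.
Qed.

(** Put [z = x + h *: d] in [is_gradient]. A basis vector [d] gives [partial]; [d = z - x] gives the
    derivative along a segment. *)
Lemma gradient_line f x g d : is_gradient f x g ->
  h^-1 * (f (x + h *: d) - f x)
    @[h --> within [set h | cube (x + h *: d)] 0^']
    --> \sum_q g 0 q * d 0 q.
Proof.
move=> fg; apply/cvgrPdist_le => e e0.
have d1 : 0 < `|d| + 1 by rewrite ltr_wpDl.
have /fg : 0 < e / (`|d| + 1) by rewrite divr_gt0.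
move=> /nbhs_ballP[r /= r0 rf].
have rd : 0 < r / (`|d| + 1) by rewrite divr_gt0.
apply/nbhs_ballP; exists (r / (`|d| + 1)) => //= h.
rewrite -ball_normE /= sub0r normrN => hr h0 ch.
have nh : `|x + h *: d - x| = `|h| * `|d| by rewrite addrC addKr normrZ.
have h0' : 0 < `|h| by rewrite normr_gt0.
have {rf} : `|f (x + h *: d) - f x - \sum_p g 0 p * ((x + h *: d) 0 p - x 0 p)|
    <= e / (`|d| + 1) * `|x + h *: d - x|.
  apply: rf => //=; rewrite -ball_normE /= -normrN opprB nh.
  move: hr; rewrite ltr_pdivlMr//; apply: le_lt_trans.
  by rewrite ler_wpM2l// lerDl.
rewrite nh (_ : \sum_p _ = h * \sum_q g 0 q * d 0 q); last first.
  by rewrite mulr_sumr; apply: eq_bigr => q _; rewrite !mxE; ring.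
move=> hf; rewrite distrC.
rewrite -[X in _ - X](mulKf h0) -mulrBr normrM normfV ler_pdivrMl//.
apply: (le_trans hf).
have -> : e / (`|d| + 1) * (`|h| * `|d|) = `|h| * e * (`|d| / (`|d| + 1)) by ring.
by rewrite ler_piMr ?mulr_ge0 ?ltW// ltr_pdivrMr// mul1r ltrDl.
Qed.

(** Properness of this filter makes the limit in [partial] unique. A coordinate in [[0, 1]] can
    always move by up to 1/2 in at least one direction. *)
Lemma dnbhs_within_proper x p : cube x ->
  ProperFilter (within [set h : R | cube (x + h *: delta_mx 0 p)] 0^').
Proof.
move=> cx; apply: Build_ProperFilter => -/nbhs_ballP[r /= r0 rf].
have cxp (h : R) : 0 <= x 0 p + h <= 1 -> cube (x + h *: delta_mx 0 p).
  move=> H q; rewrite !mxE eqxx/=; case: eqVneq => [->|_] /=.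
    by rewrite mulr1.
  by rewrite mulr0 addr0; exact: cx.
have [m [m0 mr m1]] : exists m : R, [/\ 0 < m, m < r & m <= 1 / 2].
  exists (Num.min (r / 2) (1 / 2)); split; rewrite ?lt_min ?gt_min ?ge_min; lra.
have [x1|x1] := leP (x 0 p) (1 / 2).
  apply: (rf m); first by rewrite -ball_normE /= sub0r normrN gtr0_norm.
  - by rewrite /=; apply/eqP; lra.
  - by apply: cxp; have := cx p; lra.
apply: (rf (- m)); first by rewrite -ball_normE /= sub0r opprK gtr0_norm.
- by rewrite /=; apply/eqP; lra.
- by apply: cxp; have := cx p; lra.
Qed.

Lemma partialE f x g p : cube x -> is_gradient f x g -> partial f p x = g 0 p.
Proof.
move=> cx /(@gradient_line _ _ _ (delta_mx 0 p)) fg.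
have -> : g 0 p = \sum_q g 0 q * (delta_mx 0 p : 'rV_P) 0 q.
  rewrite (bigD1 p)//= big1 ?mxE ?eqxx ?mulr1 ?addr0// => q qp.
  by rewrite mxE (negPf qp) andbF mulr0.
by apply: cvg_lim => //; exact: dnbhs_within_proper.
Qed.

Lemma is_gradient_partial f x : cube x -> differentiable_on_cube f x ->
  is_gradient f x (\row_p partial f p x).
Proof.
move=> cx [g fg]; suff -> : \row_p partial f p x = g by [].
by apply/rowP => p; rewrite mxE; exact: partialE.
Qed.

Lemma is_gradient_continuous f x g : is_gradient f x g ->
  f z @[z --> within cube (nbhs x)] --> f x.
Proof.
move=> fg; apply/cvgrPdist_le => e e0.
set B := 1 + \sum_q `|g 0 q|.
have B0 : 0 < B by rewrite ltr_pwDl// sumr_ge0.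
have [r /= r0 rf] := (nbhs_ballP _ _).1 (fg 1 ltr01).
have m0 : 0 < Num.min r (e / B) by rewrite lt_min r0 divr_gt0.
apply/nbhs_ballP; exists (Num.min r (e / B)) => //= z.
rewrite -ball_normE /= lt_min => /andP[zr ze] cz.
have := rf z; rewrite -ball_normE /= => /(_ zr cz).
rewrite mul1r => H.
have : `|f z - f x| <= B * `|z - x|.
  rewrite -(subrK (\sum_p g 0 p * (z 0 p - x 0 p)) (f z - f x)).
  apply: (le_trans (ler_normD _ _)); rewrite /B mulrDl mul1r lerD//.
  apply: (le_trans (ler_norm_sum _ _ _)); rewrite mulr_suml ler_sum// => q _.
  rewrite normrM ler_wpM2l//.
  by have := normr_coord_le (z - x) q; rewrite !mxE.
rewrite distrC => /le_trans; apply.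
by rewrite -ler_pdivlMl// mulrC ltW// distrC.
Qed.

(* The mean value theorem for [t |-> f (x + t (z - x)) - t sum_q c_q (z_q - x_q)]. *)
Lemma mean_value_cube f x z (c : 'I_P -> R) (B : R) :
  cube x -> cube z ->
  (forall w, cube w -> differentiable_on_cube f w) ->
  (forall (t : R) q, 0 <= t <= 1 ->
    `|partial f q (x + t *: (z - x)) - c q| <= B) ->
  `|f z - f x - \sum_q c q * (z 0 q - x 0 q)| <= P%:R * B * `|z - x|.
Proof.
move=> cx cz df Bf.
pose d := z - x.
pose phi (t : R) : R := f (x + t *: d).
pose dphi (t : R) : R := \sum_q partial f q (x + t *: d) * d 0 q.
have c01 t : 0 <= t <= 1 -> cube (x + t *: d) by exact: cube_segment.
have [|||t t01] := @MVT_segment _ phi dphi 0 1; first exact: ler01.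
- move=> t; rewrite in_itv /= => /andP[t0 t1].
  have t01 : 0 <= t <= 1 by lra.
  have /(@gradient_line _ _ _ d) := is_gradient_partial (c01 _ t01) (df _ (c01 _ t01)).
  under eq_bigr do rewrite mxE; rewrite -/(dphi t) => H.
  (* At an interior [t], small [h] of either sign keep the point on the segment, so the limit
     restricted to the cube is a two-sided derivative. *)
  have C : h^-1 *: (phi (h *: 1 + t) - phi t) @[h --> 0^'] --> dphi t.
    apply: cvg_trans H => S /nbhs_ballP[r /= r0 rf].
    apply/nbhs_ballP.
    exists (Num.min r (Num.min t (1 - t))) => /=.
      by rewrite !lt_min r0 t0 subr_gt0.
    move=> h; rewrite -ball_normE /= sub0r normrN !lt_min => /and3P[hr ht h1] h0.
    have E : x + t *: d + h *: d = x + (h *: 1 + t) *: d.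
      by rewrite -addrA -scalerDl [h *: 1]mulr1 [h + t]addrC.
    have := rf h; rewrite -ball_normE /= sub0r normrN E; apply => //.
    by apply: c01; rewrite [h *: 1]mulr1; move: ht h1; rewrite !ltr_norml; lra.
  split; first exact: cvgP C.
  exact: cvg_lim C.
- apply/subspace_continuousP => t /=; rewrite in_itv /= => t01.
  have ft := is_gradient_partial (c01 _ t01) (df _ (c01 _ t01)).
  apply: cvg_trans (is_gradient_continuous ft).
  move=> S /nbhs_ballP[r /= r0 rf].
  have d1 : 0 < `|d| + 1 by rewrite ltr_wpDl.
  apply/nbhs_ballP; exists (r / (`|d| + 1)); first by rewrite /= divr_gt0.
  move=> s; rewrite -ball_normE /= in_itv /= => st s01; apply: rf; last exact: c01.
  rewrite -ball_normE /= opprD addrACA subrr add0r -scalerBl normrZ.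
  move: st; rewrite ltr_pdivlMr//; apply: le_lt_trans.
  by rewrite ler_wpM2l// lerDl.
have xd : x + d = z by rewrite /d addrC subrK.
rewrite /phi scale0r addr0 scale1r xd subr0 mulr1 => ->.
rewrite /dphi -sumrB; apply: (le_trans (ler_norm_sum _ _ _)).
have -> : P%:R * B * `|z - x| = \sum_(q < P) B * `|z - x|.
  by rewrite sumr_const card_ord -mulrA mulr_natl.
rewrite ler_sum// => q _.
rewrite /d !mxE -mulrBl normrM ler_pM//; last first.
  by have := normr_coord_le (z - x) q; rewrite !mxE.
by apply: Bf; move: t01; rewrite in_itv.
Qed.

End gradient.

(** * Taylor expansion under a Hessian bound *)

Section taylor.
Context {R : realType} {P : nat}.
Implicit Types (f : 'rV[R]_P -> R) (x z : 'rV[R]_P) (p q : 'I_P).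

Lemma coord_le_euclid_norm (v : 'rV[R]_P) q : `|v 0 q| <= euclid_norm v.
Proof.
rewrite -sqrtr_sqr ler_wsqrtr// (bigD1 q)//= lerDl sumr_ge0// => i _.
exact: sqr_ge0.
Qed.

(** The entry is a coordinate of [e *m A] for a unit vector [e]. *)
Lemma entry_le_operator_norm (A : 'M[R]_P) p q : `|A p q| <= operator_norm A.
Proof.
pose e : 'rV[R]_P := delta_mx 0 p.
have -> : A p q = (e *m A) 0 q by rewrite -rowE mxE.
apply: (le_trans (coord_le_euclid_norm _ _)).
apply: ub_le_sup; last first.
  exists e => //=; rewrite /euclid_norm (bigD1 p)//= big1; last first.
    by move=> i /negPf ip; rewrite /e mxE ip andbF expr0n.
  by rewrite /e mxE !eqxx expr1n addr0 sqrtr1.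
(* An upper bound of the set, without which [sup] would be a default value. *)
exists (Num.sqrt (\sum_j (\sum_i `|A i j|) ^+ 2)) => _ [v /= v1 <-].
rewrite ler_wsqrtr// ler_sum// => j _.
rewrite -real_normK ?num_real// lerXn2r ?nnegrE ?sumr_ge0// mxE.
apply: (le_trans (ler_norm_sum _ _ _)); rewrite ler_sum// => i _.
by rewrite normrM ler_piMl// (le_trans (coord_le_euclid_norm _ _)).
Qed.

Variables (f : 'rV[R]_P -> R) (H : R).
Hypothesis f_diff2 : twice_differentiable_on_cube f.
Hypothesis f_hessian : forall x, cube x -> operator_norm (hessian f x) <= H.

(** The gradient of [partial f p] is a row of the Hessian, whose entries are at most [H] in absolute
    value. *)
Lemma partial_lipschitz x z p : cube x -> cube z ->
  `|partial f p z - partial f p x| <= P%:R * H * `|z - x|.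
Proof.
move=> cx cz.
have := @mean_value_cube _ _ (partial f p) x z (fun=> 0) H cx cz.
rewrite [\sum_q _ * _]big1 ?subr0; last by move=> q _; rewrite mul0r.
apply=> [w /f_diff2[_]//|t q t01].
rewrite subr0; have cw := cube_segment cx cz t01.
apply: le_trans (f_hessian cw).
by have := entry_le_operator_norm (hessian f (x + t *: (z - x))) p q; rewrite mxE.
Qed.

Lemma hessian_bound_ge0 x p : cube x -> 0 <= H.
Proof.
move=> cx; apply: le_trans (f_hessian cx).
exact: le_trans (entry_le_operator_norm (hessian f x) p p).
Qed.

(** The mean value inequality with [c] the gradient at [x]: along the segment each partial
    derivative moves by at most [P H |z - x|], and the sum over the coordinates gives the second
    factor [P]. *)
Lemma taylor_cube x z : cube x -> cube z ->
  `|f z - f x - \sum_q partial f q x * (z 0 q - x 0 q)|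
  <= P%:R ^+ 2 * H * `|z - x| ^+ 2.
Proof.
move=> cx cz.
have := @mean_value_cube _ _ f x z (fun q => partial f q x) (P%:R * H * `|z - x|) cx cz.
rewrite !mulrA -expr2 -[_ * _ * _ * _]mulrA -expr2; apply=> [w /f_diff2[]//|t q t01].
apply: (le_trans (partial_lipschitz _ cx (cube_segment cx cz t01))).
rewrite addrC addKr normrZ ler_wpM2l//.
  by rewrite mulr_ge0// (hessian_bound_ge0 q cx).
by rewrite ler_piMl// ler_norml; lra.
Qed.

(** The partial derivatives are bounded by their values at the origin plus their variation over the
    cube, whose points have sup norm at most 1. *)
Lemma lipschitz_cube : exists2 L : R, 0 <= L &
  forall x z, cube x -> cube z -> `|f z - f x| <= L * `|z - x|.
Proof.
have c0 : cube (0 : 'rV[R]_P) by move=> q; rewrite mxE lexx ler01.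
exists (P%:R * (\sum_q `|partial f q 0| + P%:R * `|H|)).
  by rewrite mulr_ge0// addr_ge0 ?sumr_ge0// mulr_ge0.
move=> x z cx cz.
have := @mean_value_cube _ _ f x z (fun=> 0)
  (\sum_q `|partial f q 0| + P%:R * `|H|) cx cz.
rewrite [\sum_q _ * _]big1 ?subr0; last by move=> q _; rewrite mul0r.
apply=> [w /f_diff2[]//|t q t01]; rewrite subr0.
have cw := cube_segment cx cz t01.
rewrite -[X in `|X|](subrK (partial f q 0)) addrC.
apply: (le_trans (ler_normD _ _)); apply: lerD.
  by rewrite (bigD1 q)//= lerDl sumr_ge0.
apply: (le_trans (partial_lipschitz _ c0 cw)).
rewrite subr0 -mulrA ler_wpM2l//.
rewrite -[leRHS]mulr1 ler_pM ?(hessian_bound_ge0 q c0)// ?ler_norm//.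
apply: normr_row_le => // p; have /andP[w0 w1] := cw p.
by rewrite ger0_norm.
Qed.

End taylor.

(** * Averages over boxes of nearly affine functions *)

Section uniform_mean.
Context {R : realType}.
Local Notation mu := (@lebesgue_measure R).

Lemma lipschitz_integrable (K : R) (h : R -> R) :
  (forall s t, 0 <= s <= 1 -> 0 <= t <= 1 -> `|h s - h t| <= K * `|s - t|) ->
  mu.-integrable `[0, 1] (EFin \o h).
Proof.
move=> hK; apply: continuous_compact_integrable; first exact: segment_compact.
apply/subspace_continuousP => t; rewrite /= in_itv /= => t01.
apply/cvgrPdist_le => e e0.
have K1 : 0 < `|K| + 1 by rewrite ltr_wpDl.
apply/nbhs_ballP; exists (e / (`|K| + 1)); first by rewrite /= divr_gt0.
move=> s; rewrite -ball_normE /= in_itv /= => ts s01.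
apply: (le_trans (hK _ _ t01 s01)).
rewrite ltr_pdivlMr// in ts; apply: le_trans (ltW ts).
rewrite [leRHS]mulrC ler_wpM2r// (le_trans (ler_norm _))// lerDl//.
Qed.

Lemma Rintegral01_affine (c d : R) :
  \int[mu]_(t in `[0, 1]) (c + d * t) = c + d / 2.
Proof.
have i1 k : mu.-integrable `[0, 1] (EFin \o (fun _ : R => k)).
  by apply: (@lipschitz_integrable 0) => s t _ _; rewrite subrr normr0 mul0r.
have i2 : mu.-integrable `[0, 1] (EFin \o (fun t : R => unstable.onem t ^+ 1)).
  apply: (@lipschitz_integrable 1) => s t _ _.
  rewrite !expr1 /unstable.onem mul1r (_ : _ - _ = - (s - t)) ?normrN//; ring.
have i3 : mu.-integrable `[0, 1] (EFin \o (fun t : R => - d * unstable.onem t ^+ 1)).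
  apply: (@lipschitz_integrable `|d|) => s t _ _.
  rewrite !expr1 /unstable.onem (_ : _ - _ = d * (s - t)) ?normrM//; ring.
under eq_Rintegral.
  move=> t _.
  rewrite (_ : c + d * t = (c + d) + (- d) * unstable.onem t ^+ 1); last first.
    by rewrite expr1 /unstable.onem; ring.
  over.
rewrite RintegralD// RintegralZl// Rintegral_onemXn Rintegral_cst//.
rewrite /= lebesgue_measure_itv /= lte_fin ltr01 /= oppr0 addr0; field=> //.
Qed.

(** [h] lies between the affine functions with constant terms [c - e] and [c + e], and the integral
    is monotone. The Lipschitz bound supplies integrability. *)
Lemma Rintegral01_affine_approx (K c d e : R) (h : R -> R) :
  (forall s t, 0 <= s <= 1 -> 0 <= t <= 1 -> `|h s - h t| <= K * `|s - t|) ->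
  (forall t, 0 <= t <= 1 -> `|h t - (c + d * t)| <= e) ->
  `|\int[mu]_(t in `[0, 1]) h t - (c + d / 2)| <= e.
Proof.
move=> hK he.
have ia k : mu.-integrable `[0, 1] (EFin \o (fun t : R => k + d * t)).
  apply: (@lipschitz_integrable `|d|) => s t _ _.
  by rewrite opprD addrACA subrr add0r -mulrBr normrM.
have ih := lipschitz_integrable hK.
rewrite ler_distl -!addrA ![d / 2 + _]addrC !addrA -!Rintegral01_affine.
apply/andP; split; apply: le_Rintegral => // t; rewrite /= in_itv /= => /he;
  rewrite ler_distl; lra.
Qed.

Context {P : nat} (l u : 'rV[R]_P).
Implicit Types (f g : 'rV[R]_P -> R) (z : 'rV[R]_P) (p q : 'I_P).

Definition box : set 'rV[R]_P := [set z | forall p, l 0 p <= z 0 p <= u 0 p].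

Definition coord_mean p g z : R :=
  \int[mu]_(t in `[0, 1]) g (set_coord z p (l 0 p + t * (u 0 p - l 0 p))).

Hypothesis lu : forall p, l 0 p <= u 0 p.

Lemma box_set_coord z p (t : R) : 0 <= t <= 1 -> box z ->
  box (set_coord z p (l 0 p + t * (u 0 p - l 0 p))).
Proof.
move=> t01 zb q; rewrite mxE; case: eqVneq => [->|_]; last exact: zb.
have := lu p; nra.
Qed.

Lemma set_coord_dist z z' p (s t : R) :
  `|set_coord z p s - set_coord z' p t| <= Num.max `|z - z'| `|s - t|.
Proof.
apply: normr_row_le => [|q]; first by rewrite le_max normr_ge0.
rewrite !mxE le_max; case: eqVneq => _; first by rewrite lexx orbT.
by have := normr_coord_le (z - z') q; rewrite !mxE => ->.
Qed.

Variable K : R.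
Hypothesis K0 : 0 <= K.

Lemma coord_lipschitz g p z :
  {in box &, forall z z', `|g z - g z'| <= K * `|z - z'|} -> box z ->
  forall s t, 0 <= s <= 1 -> 0 <= t <= 1 ->
  `|g (set_coord z p (l 0 p + s * (u 0 p - l 0 p))) -
    g (set_coord z p (l 0 p + t * (u 0 p - l 0 p)))|
  <= K * (u 0 p - l 0 p) * `|s - t|.
Proof.
move=> gK zb s t s01 t01.
apply: le_trans (gK _ _ _ _) _; rewrite ?inE; try exact: box_set_coord.
rewrite -mulrA ler_wpM2l// (le_trans (set_coord_dist _ _ _ _ _))//.
rewrite subrr normr0 opprD addrACA subrr add0r -mulrBl normrM mulrC.
by rewrite [`|u 0 p - _|]ger0_norm ?subr_ge0// ge_max lexx mulr_ge0 ?subr_ge0.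
Qed.

(** The difference of the averages is the average of the differences at equal [t], and giving two
    points a common coordinate does not increase their sup distance. *)
Lemma coord_mean_lipschitz g p :
  {in box &, forall z z', `|g z - g z'| <= K * `|z - z'|} ->
  {in box &, forall z z',
    `|coord_mean p g z - coord_mean p g z'| <= K * `|z - z'|}.
Proof.
move=> gK z z'; rewrite !inE => zb zb'.
pose w v t : 'rV[R]_P := set_coord v p (l 0 p + t * (u 0 p - l 0 p)).
have gl v : box v -> _ := coord_lipschitz p gK.
rewrite -RintegralB//; try by [|exact: lipschitz_integrable (gl _ _)].
rewrite -[X in `|X|]subr0 -[X in _ - X](_ : 0 + 0 / 2 = 0); last first.
  by rewrite mul0r addr0.
apply: (@Rintegral01_affine_approx (K * (u 0 p - l 0 p) + K * (u 0 p - l 0 p))).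
  have E (x1 x2 x3 x4 : R) : x1 - x2 - (x3 - x4) = (x1 - x3) - (x2 - x4) by ring.
  move=> s t s01 t01; rewrite E mulrDl.
  by apply: (le_trans (ler_normB _ _)); rewrite lerD//; exact: gl.
move=> t t01; rewrite mul0r addr0 subr0.
apply: le_trans (gK _ _ _ _) _; rewrite ?inE; try exact: box_set_coord.
rewrite ler_wpM2l// (le_trans (set_coord_dist _ _ _ _ _))//.
by rewrite subrr normr0 ge_max lexx normr_ge0.
Qed.

(** Each average replaces one coordinate in the affine function by the midpoint of its side and
    keeps the error [e]. The Lipschitz bound is part of the induction because it makes the next
    average integrable. *)
Lemma coord_means_affine_approx f (a e : R) (b : 'I_P -> R) (s : seq 'I_P) :
  uniq s ->
  {in box &, forall z z', `|f z - f z'| <= K * `|z - z'|} ->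
  {in box, forall z, `|f z - (a + \sum_q b q * z 0 q)| <= e} ->
  {in box &, forall z z', `|foldr coord_mean f s z - foldr coord_mean f s z'|
                            <= K * `|z - z'|} /\
  {in box, forall z, `|foldr coord_mean f s z -
    (a + \sum_q b q * (if q \in s then (l 0 q + u 0 q) / 2 else z 0 q))|
      <= e}.
Proof.
move=> + fK fe; elim: s => [//|p s IH] /= /andP[ps /IH[gK ge]].
split; first exact: coord_mean_lipschitz.
move=> z; rewrite inE => zb.
(* The contribution of the other coordinates, constant while coordinate [p] is averaged. *)
pose r := \sum_(q | q != p) b q * (if q \in s then (l 0 q + u 0 q) / 2 else z 0 q).
rewrite (bigD1 p)//= mem_head (eq_bigr
    (fun q => b q * (if q \in s then (l 0 q + u 0 q) / 2 else z 0 q))); last first.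
  by move=> q /negPf qp; rewrite in_cons qp.
rewrite -/r.
rewrite (_ : a + _ = (a + b p * l 0 p + r) + b p * (u 0 p - l 0 p) / 2); last by field.
apply: Rintegral01_affine_approx; first exact: coord_lipschitz.
move=> t t01; set w := set_coord z p _.
have /ge : w \in box by rewrite inE; exact: box_set_coord.
rewrite (bigD1 p)//= (negPf ps) (eq_bigr
    (fun q => b q * (if q \in s then (l 0 q + u 0 q) / 2 else z 0 q))); last first.
  by move=> q /negPf qp; rewrite mxE qp.
rewrite -/r mxE eqxx; congr (`|_ - _| <= _); ring.
Qed.

Lemma uniform_mean_affine_approx f (a e : R) (b : 'I_P -> R) :
  {in box &, forall z z', `|f z - f z'| <= K * `|z - z'|} ->
  {in box, forall z, `|f z - (a + \sum_q b q * z 0 q)| <= e} ->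
  `|uniform_mean l u f - (a + \sum_q b q * ((l 0 q + u 0 q) / 2))| <= e.
Proof.
move=> fK fe.
have [_ /(_ l)] := coord_means_affine_approx (enum_uniq 'I_P) fK fe.
rewrite inE => /(_ _); under eq_bigr do rewrite mem_enum/=.
by apply => q; rewrite lexx lu.
Qed.

End uniform_mean.

(** * Geometry of the cells, and the slope of a node *)

Section cells.
Context {R : realType} {P : nat} (P_gt0 : (0 < P)%N).

Lemma median_itv (s : seq R) (a b : R) : s != [::] ->
  {in s, forall t, a <= t <= b} -> a <= median s <= b.
Proof.
move=> s0 sab.
have n j : (j < size s)%N -> a <= nth 0 (sort <=%O s) j <= b.
  by move=> js; apply: sab; rewrite -(mem_sort <=%O) mem_nth// size_sort.
have s1 : (0 < size s)%N by rewrite lt0n size_eq0.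
have /n h1 : ((size s).-1./2 < size s)%N by lia.
have /n h2 : ((size s)./2 < size s)%N by lia.
by rewrite /median; move: h1 h2; lra.
Qed.

Variables (N : nat) (X : nat -> 'rV[R]_P).
Hypothesis X_cube : forall n, cube (X n).

Definition cell_box (c : @cell R P) : set 'rV[R]_P := box (lo c) (hi c).

(** The invariant carried down the tree. Its last clause places the median inside the extent, so
    that a cut gives well-ordered extents again. *)
Definition wf_cell (c : @cell R P) : Prop :=
  [/\ forall q, lo c 0 q <= hi c 0 q, cell_box c `<=` cube &
      {in obs c, forall n, cell_box c (X n)}].

Lemma cell_threshold_itv p c : wf_cell c ->
  lo c 0 p <= cell_threshold X p c <= hi c 0 p.
Proof.
case=> lh _ oc; rewrite /cell_threshold; have := lh p.
case E : (obs c) => [|n s]; first lra.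
by move=> _; apply: median_itv => // t /mapP[m ms ->]; apply: oc; rewrite E.
Qed.

Lemma cell_child_sub p b c : wf_cell c ->
  cell_box (cell_child X p b c) `<=` cell_box c.
Proof.
move=> wc z zc q; have := zc q; have := cell_threshold_itv p wc.
by case: b {zc}; rewrite /= mxE; case: eqVneq => [->|_]; lra.
Qed.

Lemma cell_child_wf p b c : wf_cell c -> wf_cell (cell_child X p b c).
Proof.
move=> wc; have ts := cell_child_sub wc; have [lh cc oc] := wc.
have tp := cell_threshold_itv p wc; split.
- move=> q; have := lh q.
  by case: b {ts}; rewrite /= mxE; case: eqVneq => [->|_]; lra.
- by move=> z /ts/cc.
- case: b {ts} => n /=; rewrite mem_filter => /andP[tn /oc nc] q;
    have := nc q; rewrite /= mxE; case: eqVneq => [->|_]; lra.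
Qed.

Lemma cell_of_wf i : wf_cell (cell_of P_gt0 N X i).
Proof.
elim: i => [|b i IH]; last exact: cell_child_wf.
split=> [q|z zb q|n _ q] /=; first by rewrite !mxE.
- by have := zb q; rewrite !mxE.
- by rewrite !mxE; exact: X_cube.
Qed.

Lemma size_node_at x k : size (node_at P_gt0 N X x k) = k.
Proof. by elim: k => //= k ->. Qed.

Lemma node_at_box x k : cube x ->
  cell_box (cell_of P_gt0 N X (node_at P_gt0 N X x k)) x.
Proof.
move=> cx; elim: k => [|k IH] q; first by rewrite !mxE; exact: cx.
have := IH q; rewrite /= /threshold !size_node_at.
by case: ltP => tx /=; rewrite mxE; case: eqVneq => [->|_]; lra.
Qed.

(** For [P <= S], the largest depth below [S] congruent to [p] modulo [P]; then [p <= S.-1], so the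
    truncated subtraction is exact. *)
Definition last_split (S : nat) (p : 'I_P) : nat := (S.-1 - p) %/ P * P + p.

Lemma last_splitP S p : (P <= S)%N ->
  (last_split S p < S <= last_split S p + P)%N.
Proof.
move=> PS; have := ltn_ord p; have := ltn_pmod (S.-1 - p) P_gt0.
have := divn_eq (S.-1 - p) P; rewrite /last_split; lia.
Qed.

Lemma split_var_last_split S p : split_var P_gt0 (last_split S p) = p.
Proof. by apply/val_inj; rewrite /= modnMDl modn_small. Qed.

Lemma tbge_last_split (y : nat -> R) S x p : (P <= S)%N ->
  tbge P_gt0 N X y S x p =
  node_slope P_gt0 N X y (node_at P_gt0 N X x (last_split S p)).
Proof.
move=> /(last_splitP p)/andP[]; rewrite /tbge.
have := split_var_last_split S p; set k := last_split S p => kp kS Sk.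
(* Separate the depths before [k], [k] itself, and the [S - k.+1] depths after it. The latter exceed
   [k] by less than [P], so none of them splits along [p]. *)
rewrite (_ : S = (k + (S - k.+1).+1)%N); last lia.
rewrite iotaD filter_cat map_cat last_cat add0n /= kp eqxx /=.
rewrite (_ : [seq _ <- _ | _] = [::])//.
apply/eqP; rewrite -[_ == _]negbK -has_filter; apply/hasPn => j.
rewrite mem_iota => /andP[kj jS]; apply/eqP; rewrite -kp => /(congr1 val)/=/eqP.
have jk : (0 < j - k < P)%N by move: kj jS kS Sk; clear; lia.
by case/andP: jk => jk0 jkP; rewrite eqn_mod_dvd ?gtnNdvd// ltnW.
Qed.

Variables (y : nat -> R) (f : 'rV[R]_P -> R) (L C : R).
Hypothesis L_ge0 : 0 <= L.
Hypothesis f_lipschitz :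
  forall x z, cube x -> cube z -> `|f z - f x| <= L * `|z - x|.
Hypothesis f_taylor : forall x z, cube x -> cube z ->
  `|f z - f x - \sum_q partial f q x * (z 0 q - x 0 q)| <= C * `|z - x| ^+ 2.

(** The affine function is the first-order Taylor polynomial of [f] at [x]. The child need not
    contain [x], but the parent contains both, so every point of the child is within [r] of [x]. *)
Lemma child_mean_approx x k (c : bool) (r : R) :
  let i := node_at P_gt0 N X x k in
  cube x -> 0 <= C -> 0 <= r -> (forall q, width P_gt0 N X i q <= r) ->
  `|uniform_mean (lower P_gt0 N X (c :: i)) (upper P_gt0 N X (c :: i)) f
    - (f x - \sum_q partial f q x * x 0 q + \sum_q partial f q x *
        ((lower P_gt0 N X (c :: i) 0 q + upper P_gt0 N X (c :: i) 0 q) / 2))|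
  <= C * r ^+ 2.
Proof.
move=> i cx C0 r0 wr.
have [lh cc _] := cell_of_wf (c :: i).
have csub : cell_box (cell_of P_gt0 N X (c :: i)) `<=`
    cell_box (cell_of P_gt0 N X i) by apply/cell_child_sub/cell_of_wf.
have xi : cell_box (cell_of P_gt0 N X i) x by exact: node_at_box.
have := @uniform_mean_affine_approx _ _ _ _ lh L L_ge0 f
  (f x - \sum_q partial f q x * x 0 q) (C * r ^+ 2) (fun q => partial f q x).
apply.
  by move=> z z'; rewrite !inE => /cc cz /cc cz'; rewrite f_lipschitz.
move=> z; rewrite inE => zb.
have := f_taylor cx (cc _ zb); under eq_bigr do rewrite mulrBr.
have E (t1 t2 t3 t4 : R) : t1 - t2 - (t3 - t4) = t1 - (t2 - t4 + t3) by ring.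
rewrite sumrB E => /le_trans; apply.
rewrite ler_wpM2l// lerXn2r ?nnegrE//.
apply: normr_row_le => // q; rewrite !mxE.
have := csub _ zb q; have := xi q; have := wr q; rewrite /width/upper/lower.
by move=> w1 x1 z1; rewrite ler_norml; lra.
Qed.

(** Two sample means off by [m] and two box averages off by [C r^2], doubled by the factor 2 of the
    slope, give the constant 4. *)
Lemma node_slope_error x k (m r : R) :
  let i := node_at P_gt0 N X x k in let p := split_var P_gt0 k in
  cube x -> 0 <= C -> (forall q, width P_gt0 N X i q <= r) ->
  0 < width P_gt0 N X i p ->
  (forall c : bool, `|node_mean P_gt0 N X y (c :: i)
    - uniform_mean (lower P_gt0 N X (c :: i)) (upper P_gt0 N X (c :: i)) f| <= m) ->
  `|node_slope P_gt0 N X y i - partial f p x|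
    <= 4 * (m + C * r ^+ 2) / width P_gt0 N X i p.
Proof.
move=> i p cx C0 wr wp hm.
have r0 : 0 <= r by apply: le_trans (ltW wp) (wr p).
have t1 := child_mean_approx true cx C0 r0 wr.
have t0 := child_mean_approx false cx C0 r0 wr.
have m1 := hm true; have m0 := hm false.
rewrite -/i in t1 t0.
set A := f x - _ in t1 t0.
set S1 := \sum_q _ in t1; set S0 := \sum_q _ in t0.
(* With threshold [t] the midpoints along [p] are [(l_p + t) / 2] and [(t + u_p) / 2], so [t]
   cancels. *)
have S10 : S1 - S0 = partial f p x * width P_gt0 N X i p / 2.
  rewrite /S1 /S0 -sumrB (bigD1 p)//= big1 ?addr0 => [|q qp].
    by rewrite /lower /upper /= size_node_at -/p !mxE eqxx /width /upper /lower; field.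
  by rewrite /lower /upper /= size_node_at -/p !mxE (negPf qp) subrr.
rewrite /node_slope size_node_at -/p.
set W := width _ _ _ _ _ in S10 wp *.
rewrite -[X in _ - X](mulfK (lt0r_neq0 wp)) -mulrBl normrM normfV.
rewrite (gtr0_norm wp) ler_pM2r ?invr_gt0//.
move: t1 t0 m1 m0 S10; rewrite !ler_norml.
set M1 := node_mean _ _ _ _ _; set M0 := node_mean _ _ _ _ _.
set U1 := uniform_mean _ _ _; set U0 := uniform_mean _ _ _.
lra.
Qed.

End cells.

(** * Union bound and comparison of rates *)

Lemma outer_measure_bigsetU_le (R : realType) (T : Type)
  (mu : {outer_measure set T -> \bar R}) (I : Type) (s : seq I)
  (A : I -> set T) (e : R) :
  (forall i, mu (A i) <= e%:E)%E ->
  (mu (\big[setU/set0]_(i <- s) A i) <= ((size s)%:R * e)%:E)%E.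
Proof.
move=> Ae; elim: s => [|i s IH]; first by rewrite big_nil outer_measure0 mul0r.
rewrite big_cons; apply: (le_trans (outer_measureU2 _ _ _)).
by rewrite /= -nat1r mulrDl mul1r EFinD leeD.
Qed.

(** The order of the sampling error divided by that of the width. The exponents give
    [S/2 + k/P <= S/2 + S/P], which is [(P + 2) / (2 P) * S]. *)
Lemma sqrt_rate_div (R : realType) (P S k : nat) (n : R) : (0 < P)%N ->
  (k <= S)%N -> 0 <= n ->
  Num.sqrt (2 ^+ S / n) / 2 `^ (- (k%:R / P%:R))
  <= 2 `^ ((P + 2)%:R / (2 * P)%:R * S%:R) / Num.sqrt n.
Proof.
move=> P0 kS n0; have P0' : 0 < P%:R :> R by rewrite ltr0n.
rewrite sqrtrM ?exprn_ge0// sqrtrV// mulrAC ler_wpM2r ?invr_ge0 ?sqrtr_ge0//.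
rewrite -powRN opprK -powR12_sqrt ?exprn_ge0// -powR_mulrn// -powRrM -powRD; last first.
  by rewrite pnatr_eq0 implybT.
rewrite ler_powR ?ler1n//.
rewrite natrD natrM (_ : _ / _ * _ = S%:R * 2^-1 + S%:R / P%:R); last first.
  by field; rewrite lt0r_neq0.
by rewrite lerD2l ler_pM2r ?invr_gt0// ler_nat.
Qed.

(** Since [k >= S - P], replacing [k] by [S] costs at most a factor [2 ^ (P/P) = 2]. *)
Lemma cell_diameter_rate (R : realType) (P S k : nat) : (0 < P)%N ->
  (S <= k + P)%N ->
  2 `^ (- (k%:R / P%:R)) <= 2 * 2 `^ (- (S%:R / P%:R)) :> R.
Proof.
move=> P0 Sk; have P0' : 0 < P%:R :> R by rewrite ltr0n.
rewrite -{2}[2](@powRr1 R)// -powRD; last by rewrite pnatr_eq0 implybT.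
rewrite ler_powR ?ler1n// -subr_ge0.
rewrite (_ : _ - _ = (k%:R + P%:R - S%:R) / P%:R); last first.
  by field; rewrite lt0r_neq0.
by rewrite divr_ge0// subr_ge0 -natrD ler_nat.
Qed.

Theorem theorem4p1 (R : realType) (P : nat) (P_gt0 : (0 < P)%N)
  (d : measure_display) (T : measurableType d) (Pr : probability T R)
  (f : 'rV[R]_P -> R)
  (X : nat -> T -> 'rV[R]_P) (eps : nat -> {RV Pr >-> R}) (y : nat -> T -> R)
  (depth : nat -> nat)
  (* data *)
  (X_measurable : forall n p, measurable_fun setT (fun w => X n w 0 p))
  (X_cube : forall n w, cube (X n w))
  (eps_mean : forall n, ('E_Pr[eps n] = 0)%E)
  (eps_variance : forall n, ('V_Pr[eps n] < +oo)%E)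
  (y_def : forall n w, y n w = f (X n w) + eps n w)
  (* Assumption 0 *)
  (depth_infty : depth @ \oo --> \oo)
  (depth_log : (depth N)%:R / ln N%:R @[N --> \oo] --> (0 : R))
  (* Assumption 1 *)
  (extent : forall e : R, 0 < e ->
    exists Cm Cp : R, [/\ 0 < Cm, 0 < Cp &
      \forall N \near \oo,
        let bounds (i : T -> node) (p : 'I_P) :=
          [set w | Cm * 2 `^ (- ((size (i w))%:R / P%:R))
                     <= `|width P_gt0 N (X ^~ w) (i w) p|
                     <= Cp * 2 `^ (- ((size (i w))%:R / P%:R))] in
        (forall (i : node) (p : 'I_P), (size i <= depth N)%N ->
           probability_gt Pr (bounds (fun=> i) p) (1 - e)) /\
        (forall (x : 'rV[R]_P) (k : nat) (p : 'I_P),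
           cube x -> (k <= depth N)%N ->
           probability_gt Pr
             (bounds (fun w => node_at P_gt0 N (X ^~ w) x k) p) (1 - e))])
  (* Assumption 2 (1) *)
  (node_means : forall (x : 'rV[R]_P) (k : nat -> nat) (c : bool),
    cube x -> (\forall N \near \oo, (k N < depth N)%N) ->
    bounded_in_probability Pr
      (fun N w =>
         let i := c :: node_at P_gt0 N (X ^~ w) x (k N) in
         node_mean P_gt0 N (X ^~ w) (y ^~ w) i
         - uniform_mean (lower P_gt0 N (X ^~ w) i)
                        (upper P_gt0 N (X ^~ w) i) f)
      (fun N => Num.sqrt (2 ^+ depth N / N%:R)))
  (* Assumption 2 (2) *)
  (f_diff2 : twice_differentiable_on_cube f)
  (f_hessian : exists H : R, forall x, cube x ->
    operator_norm (hessian f x) <= H) :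
  forall (x : 'rV[R]_P) (p : 'I_P), cube x ->
    bounded_in_probability Pr
      (fun N w => tbge P_gt0 N (X ^~ w) (y ^~ w) (depth N) x p - partial f p x)
      (fun N => 2 `^ ((P + 2)%:R / (2 * P)%:R * (depth N)%:R) / Num.sqrt N%:R
                + P%:R * 2 `^ (- ((depth N)%:R / P%:R))).
Proof.
move=> x p cx e e0.
have [H f_H] := f_hessian.
have H0 := hessian_bound_ge0 f_H p cx.
have [L L0 f_L] := lipschitz_cube f_diff2 f_H.
have [C C0 f_taylor] : exists2 C : R, 0 <= C & forall x z, cube x -> cube z ->
    `|f z - f x - \sum_q partial f q x * (z 0 q - x 0 q)| <= C * `|z - x| ^+ 2.
  exists (P%:R ^+ 2 * H); first by rewrite mulr_ge0 ?sqr_ge0.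
  by move=> *; exact: taylor_cube.
have P3 : 0 < (P + 3)%:R :> R by rewrite ltr0n addnS.
(* The bad event is a union of [P + 2] events, two for the sample means and one for each side of the
   node; one more share makes the final inequality strict. *)
pose e' := e / (P + 3)%:R; have e'0 : 0 < e' by rewrite divr_gt0.
have [Cm [Cp [Cm0 Cp0 ext]]] := extent _ e'0.
have deep : \forall N \near \oo, (P <= depth N)%N.
  exact: (depth_infty _ (nbhs_infty_ge P)).
pose k N := last_split (depth N) p.
have k_lt : \forall N \near \oo, (k N < depth N)%N.
  by apply: filterS deep => N /(last_splitP P_gt0 p)/andP[].
have [Ml Ml0 left_mean] := node_means x k false cx k_lt _ e'0.
have [Mr Mr0 right_mean] := node_means x k true cx k_lt _ e'0.
(* The slope error with [m = (Ml + Mr) * rho], [r = Cp * a] and width at least [Cm * a]. The 8 is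
   the 4 of [node_slope_error] times the 2 of [cell_diameter_rate]. *)
exists (4 * (Ml + Mr) / Cm + 8 * C * Cp ^+ 2 / Cm).
  apply: ltr_pwDl; first by rewrite divr_gt0// mulr_gt0// addr_gt0.
  by apply: divr_ge0 (ltW Cm0); rewrite mulr_ge0 ?sqr_ge0// mulr_ge0.
apply: filterS3 deep ext (filterI left_mean right_mean) => N PS [_ ext] [lN rN].
have /andP[kS Sk] := last_splitP P_gt0 p PS; rewrite -/(k N) in kS Sk.
pose i w := node_at P_gt0 N (X ^~ w) x (k N).
(* [a] is the scale of the sides of the node, [rho] that of the errors of the sample means. *)
pose a : R := 2 `^ (- ((k N)%:R / P%:R)).
pose rho : R := Num.sqrt (2 ^+ depth N / N%:R).
pose bad_mean (c : bool) (M : R) := [set w | M * rho <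
  `|node_mean P_gt0 N (X ^~ w) (y ^~ w) (c :: i w)
    - uniform_mean (lower P_gt0 N (X ^~ w) (c :: i w))
                   (upper P_gt0 N (X ^~ w) (c :: i w)) f|].
pose bad_width q := ~` [set w |
  Cm * a <= `|width P_gt0 N (X ^~ w) (i w) q| <= Cp * a].
have bad_widthP q : ((Pr^*)%mu (bad_width q) <= e'%:E)%E.
  have := ext x (k N) q cx (ltnW kS); rewrite /probability_gt subKr => /ltW.
  congr (((Pr^*)%mu (~` _) <= _)%E).
  by apply/seteqP; split=> w /=; rewrite size_node_at.
apply: (@le_lt_trans _ _ ((Pr^*)%mu (bad_mean false Ml `|` (bad_mean true Mr
    `|` \big[setU/set0]_(q <- enum 'I_P) bad_width q)))).
  (* Outside the bad events the error bound is deterministic. *)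
  apply: le_outer_measure => w; apply: contraPP => good.
  apply/negP; rewrite -leNgt.
  have [/negP gl /not_orP[/negP gr gw]] := (not_orP _ _).1 good.
  rewrite -leNgt in gl; rewrite -leNgt in gr.
  have gwq q : Cm * a <= width P_gt0 N (X ^~ w) (i w) q <= Cp * a.
    have : ~ bad_width q w.
      move=> bq; apply: gw; rewrite -bigcup_seq; exists q => //=.
      by rewrite mem_enum.
    move/contrapT; rewrite /= ger0_norm//.
    have [lh _ _] := cell_of_wf P_gt0 N (fun n => X_cube n w) (i w).
    by rewrite subr_ge0 lh.
  have a0 : 0 < a by exact: powR_gt0.
  have rho0 : 0 <= rho by exact: sqrtr_ge0.
  have Cma : 0 < Cm * a by rewrite mulr_gt0.
  have wp : 0 < width P_gt0 N (X ^~ w) (i w) p.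
    by have /andP[+ _] := gwq p; exact: lt_le_trans.
  rewrite tbge_last_split//.
  have := @node_slope_error _ _ P_gt0 N (X ^~ w) (fun n => X_cube n w) (y ^~ w)
    f L C L0 f_L f_taylor x (k N) ((Ml + Mr) * rho) (Cp * a) cx C0.
  rewrite /= split_var_last_split -/(i w) => slope.
  apply: (le_trans (slope _ wp _)) => {slope}.
  - by move=> q; have /andP[] := gwq q.
  - case; [apply: le_trans gr _|apply: le_trans gl _];
      by rewrite ler_wpM2r// ?lerDl ?lerDr ltW.
  set W := width _ _ _ _ _ in wp *.
  apply: (@le_trans _ _
      (4 * ((Ml + Mr) * rho + C * (Cp * a) ^+ 2) * (Cm * a)^-1)).
    rewrite ler_wpM2l//.
      have [Ml0' Mr0'] := (ltW Ml0, ltW Mr0).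
      apply: mulr_ge0 => //.
      by apply: addr_ge0; apply: mulr_ge0; rewrite ?addr_ge0 ?sqr_ge0.
    by rewrite lef_pV2 ?posrE//; have /andP[] := gwq p.
  (* Sampling error and bias separate: [rho / a] is bounded by [sqrt_rate_div], [a] by
     [cell_diameter_rate]. *)
  rewrite (_ : 4 * ((Ml + Mr) * rho + C * (Cp * a) ^+ 2) / (Cm * a)
      = 4 * (Ml + Mr) / Cm * (rho / a)
      + 4 * C * Cp ^+ 2 / Cm * a); last first.
    by field; rewrite !lt0r_neq0.
  have r1 := sqrt_rate_div P_gt0 (ltnW kS) (ler0n R N).
  have r2 := cell_diameter_rate R P_gt0 Sk.
  rewrite -/a -/rho in r1 r2.
  set r1' := _ / Num.sqrt _ in r1 *; set r2' := 2 `^ _ in r2 *.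
  have r1'0 : 0 <= r1' by rewrite divr_ge0 ?powR_ge0 ?sqrtr_ge0.
  have r2'0 : 0 <= r2' by exact: powR_ge0.
  have Pr2 : r2' <= P%:R * r2' by rewrite ler_peMl// ler1n.
  set c1 := 4 * (Ml + Mr) / Cm; set c2 := 4 * C * Cp ^+ 2 / Cm.
  have c1_0 : 0 <= c1 by apply/ltW/divr_gt0 => //; rewrite mulr_gt0// addr_gt0.
  have c2_0 : 0 <= c2.
    by apply: divr_ge0 (ltW Cm0); rewrite mulr_ge0 ?sqr_ge0// mulr_ge0.
  rewrite (_ : 8 * C * Cp ^+ 2 / Cm = 2 * c2); last first.
    by rewrite /c2; field; exact: lt0r_neq0.
  have h1 : c1 * (rho / a) <= c1 * r1' by rewrite ler_wpM2l.
  have h2 : c2 * a <= c2 * (2 * (P%:R * r2')).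
    by rewrite ler_wpM2l// (le_trans r2)// ler_pM2l.
  (* Expanding the constant times the rate also produces two cross terms, both nonnegative. *)
  have h3 : 0 <= c1 * (P%:R * r2') by rewrite mulr_ge0// mulr_ge0.
  have h4 : 0 <= c2 * r1' by rewrite mulr_ge0.
  by move: h1 h2 h3 h4; lra.
apply: (le_lt_trans (outer_measureU2 _ _ _)).
apply: (@le_lt_trans _ _ (e' + (e' + (size (enum 'I_P))%:R * e'))%:E).
  rewrite !EFinD leeD//; first exact: ltW.
  apply: (le_trans (outer_measureU2 _ _ _)); rewrite leeD//; first exact: ltW.
  exact: outer_measure_bigsetU_le.
rewrite lte_fin size_enum_ord [ltRHS](_ : e = (P + 3)%:R * e').
  by rewrite natrD; move: e'0; lra.
by rewrite /e' mulrC divfK// lt0r_neq0.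
Qed.
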